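(* A factorization of $\Delta^2$ into powers of positive half-twists in $B_3$ cannot have precisely three factors, where one factor is the cube of a positive half-twist.
   Context: $B_3=\langle\sigma_1,\sigma_2:\sigma_1\sigma_2\sigma_1=\sigma_2\sigma_1\sigma_2\rangle$ and $\Delta=\sigma_1\sigma_2\sigma_1$. A positive half-twist is a conjugate of $\sigma_1$ in $B_3$; a power of a positive half-twist means an $e$th power with $e\ge1$ a positive integer, i.e. a conjugate of $\sigma_1^e$. A factorization of $g$ is a tuple $(g_1,\dots,g_k)$ of elements of $B_3$ with $g=g_1\cdots g_k$; $k$ is its number of factors. *)

(* Defs.v *)
(* MathComp, with boolp for the (a priori undecidable) quotient defining B3. *)
From HB Require Import structures.
From mathcomp Require Import all_boot.
From mathcomp Require Import boolp.

Set Implicit Arguments.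
Unset Strict Implicit.
Unset Printing Implicit Defensive.

Import Monoid.Theory.
Local Open Scope group_scope.
Local Open Scope quotient_scope.

(* A letter (i, e) is sigma_1 or its inverse if i = false, sigma_2 or its
   inverse if i = true; it is the inverse generator exactly when e = true. *)
Definition letter : Type := bool * bool.
Definition word : Type := seq letter.

Definition inv_letter (x : letter) : letter := (x.1, ~~ x.2).
Definition inv_word (w : word) : word := rev (map inv_letter w).

Definition s1 : letter := (false, false).
Definition s2 : letter := (true, false).

(* The congruence on words defining <sigma_1, sigma_2 : s1 s2 s1 = s2 s1 s2>
   as a group. *)
Inductive braid_eq : word -> word -> Prop :=
| braid_refl w : braid_eq w w
| braid_sym w w' : braid_eq w w' -> braid_eq w' w
| braid_trans w2 w1 w3 : braid_eq w1 w2 -> braid_eq w2 w3 -> braid_eq w1 w3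
| braid_cat u u' v v' :
    braid_eq u u' -> braid_eq v v' -> braid_eq (u ++ v) (u' ++ v')
| braid_cancel x : braid_eq [:: x; inv_letter x] [::]
| braid_rel : braid_eq [:: s1; s2; s1] [:: s2; s1; s2].

Definition braid_eqb : rel word := fun u v => `[< braid_eq u v >].

Lemma braid_eqb_refl : reflexive braid_eqb.
Proof. by move=> w; apply/asboolP; apply: braid_refl. Qed.

Lemma braid_eqb_sym : symmetric braid_eqb.
Proof.
by move=> u v; apply/asboolP/asboolP; apply: braid_sym.
Qed.

Lemma braid_eqb_trans : transitive braid_eqb.
Proof.
move=> v u w /asboolP uv /asboolP vw; apply/asboolP.
exact: braid_trans uv vw.
Qed.

Canonical braid_equiv :=
  EquivRel braid_eqb braid_eqb_refl braid_eqb_sym braid_eqb_trans.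

Definition B3 : Type := {eq_quot braid_equiv}.

HB.instance Definition _ := Choice.on B3.

Definition braid_of (w : word) : B3 := \pi_{eq_quot braid_equiv} w.
Definition word_of (x : B3) : word := repr (x : {eq_quot braid_equiv}).

Lemma word_ofK : cancel word_of braid_of.
Proof. exact: reprK. Qed.

Lemma braid_ofP (u v : word) : braid_of u = braid_of v <-> braid_eq u v.
Proof.
by split=> [/eqmodP/asboolP // | uv]; apply/eqmodP/asboolP.
Qed.

Lemma braid_of_ind (P : B3 -> Prop) :
  (forall w, P (braid_of w)) -> forall x, P x.
Proof. by move=> Pw x; rewrite -[x]word_ofK. Qed.

Lemma word_of_braid (w : word) : braid_eq (word_of (braid_of w)) w.
Proof. by apply/braid_ofP; rewrite word_ofK. Qed.

Lemma inv_letterK : involutive inv_letter.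
Proof. by case=> i e; rewrite /inv_letter /= negbK. Qed.

Lemma inv_word_cat u v : inv_word (u ++ v) = inv_word v ++ inv_word u.
Proof. by rewrite /inv_word map_cat rev_cat. Qed.

Lemma inv_wordK : involutive inv_word.
Proof. by move=> w; rewrite /inv_word map_rev revK (mapK inv_letterK). Qed.

Lemma braid_catV w : braid_eq (w ++ inv_word w) [::].
Proof.
elim: w => [|x w IHw]; first exact: braid_refl.
have -> : (x :: w) ++ inv_word (x :: w)
  = [:: x] ++ ((w ++ inv_word w) ++ [:: inv_letter x]).
  by rewrite -cat1s inv_word_cat -!catA.
apply: braid_trans (braid_cancel x).
rewrite -[X in braid_eq _ X]/([:: x] ++ ([::] ++ [:: inv_letter x])).
by do ![apply: braid_cat => //; try exact: braid_refl].
Qed.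

Lemma braid_catVl w : braid_eq (inv_word w ++ w) [::].
Proof. by have := braid_catV (inv_word w); rewrite inv_wordK. Qed.

Lemma braid_inv u v : braid_eq u v -> braid_eq (inv_word u) (inv_word v).
Proof.
move=> uv; apply: (@braid_trans (inv_word u ++ (v ++ inv_word v))).
  rewrite -[X in braid_eq X _]cats0.
  by apply: braid_cat; [exact: braid_refl | apply/braid_sym/braid_catV].
rewrite catA -[X in braid_eq _ X]cat0s.
apply: braid_cat; last exact: braid_refl.
apply: braid_trans (braid_catVl u).
by apply: braid_cat; [exact: braid_refl | exact: braid_sym].
Qed.

Definition B3_one : B3 := braid_of [::].
Definition B3_mul (x y : B3) : B3 := braid_of (word_of x ++ word_of y).
Definition B3_inv (x : B3) : B3 := braid_of (inv_word (word_of x)).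

Lemma B3_mulE u v : B3_mul (braid_of u) (braid_of v) = braid_of (u ++ v).
Proof. by apply/braid_ofP/braid_cat; apply: word_of_braid. Qed.

Lemma B3_invE u : B3_inv (braid_of u) = braid_of (inv_word u).
Proof. exact/braid_ofP/braid_inv/word_of_braid. Qed.

Lemma B3_mulA : associative B3_mul.
Proof.
elim/braid_of_ind=> u; elim/braid_of_ind=> v; elim/braid_of_ind=> w.
by rewrite (B3_mulE v w) (B3_mulE u v) (B3_mulE u) B3_mulE catA.
Qed.

Lemma B3_mul1 : left_id B3_one B3_mul.
Proof. by elim/braid_of_ind=> u; rewrite (B3_mulE [::]). Qed.

Lemma B3_1mul : right_id B3_one B3_mul.
Proof. by elim/braid_of_ind=> u; rewrite (B3_mulE u [::]) cats0. Qed.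

Lemma B3_mulV : left_inverse B3_one B3_inv B3_mul.
Proof.
elim/braid_of_ind=> u; rewrite B3_invE B3_mulE.
exact/braid_ofP/braid_catVl.
Qed.

Lemma B3_Vmul : right_inverse B3_one B3_inv B3_mul.
Proof.
elim/braid_of_ind=> u; rewrite B3_invE B3_mulE.
exact/braid_ofP/braid_catV.
Qed.

HB.instance Definition _ :=
  isGroup.Build B3 B3_mulA B3_mul1 B3_1mul B3_mulV B3_Vmul.

Lemma braid_ofM u v : braid_of (u ++ v) = braid_of u * braid_of v.
Proof. by rewrite -B3_mulE. Qed.

Definition sigma1 : B3 := braid_of [:: s1].
Definition sigma2 : B3 := braid_of [:: s2].

Lemma sigma_braid : sigma1 * sigma2 * sigma1 = sigma2 * sigma1 * sigma2.
Proof. by rewrite /sigma1 /sigma2 -!braid_ofM; apply/braid_ofP; exact: braid_rel. Qed.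

(* Existence half of the universal property of the presentation. *)
Lemma B3_universal (G : groupType) (a b : G) : a * b * a = b * a * b ->
  exists f : B3 -> G,
    [/\ f sigma1 = a, f sigma2 = b & forall x y, f (x * y) = f x * f y].
Proof.
move=> ab.
pose g (x : letter) : G := let c := if x.1 then b else a in
  if x.2 then c^-1 else c.
pose h (w : word) : G := \prod_(x <- w) g x.
have hD u v : h (u ++ v) = h u * h v by rewrite /h big_cat.
have hP u v : braid_eq u v -> h u = h v.
  elim=> {u v} // [u v w _ -> _ -> //|u u' v v' _ e _ e'|[i [|]]|].
  - by rewrite !hD e e'.
  - by rewrite /h !big_cons big_nil /g /= mulg1 mulVg.
  - by rewrite /h !big_cons big_nil /g /= mulg1 mulgV.
  by rewrite /h !big_cons big_nil /g /= !mulg1 !mulgA.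
have hE w : h (word_of (braid_of w)) = h w by apply/hP/word_of_braid.
exists (fun x => h (word_of x)); split.
- by rewrite hE /h big_seq1.
- by rewrite hE /h big_seq1.
by move=> x y; rewrite -hD; apply: hE.
Qed.

Definition Delta : B3 := sigma1 * sigma2 * sigma1.

Definition positive_half_twist (x : B3) : Prop := exists y, x = sigma1 ^ y.

Definition half_twist_power (x : B3) : Prop :=
  exists (e : nat) (t : B3), [/\ (1 <= e)%N, positive_half_twist t & x = t ^+ e].

Definition half_twist_cube (x : B3) : Prop :=
  exists t : B3, positive_half_twist t /\ x = t ^+ 3.

Definition factorization (k : nat) (g : B3) (s : k.-tuple B3) : Prop :=
  g = \prod_(i < k) tnth s i.

(* Main.v *)
Require Import Defs.
From HB Require Import structures.
From mathcomp Require Import all_boot.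
From mathcomp Require Import all_fingroup all_algebra.

(** The braid group [B_3] maps to [GL_2(F_3)] by the reduction modulo 3 of its
    action on the homology of a once-punctured torus: half-twists go to
    transvections, which have order 3, and [Delta^2] goes to [-1].  A cube of a
    half-twist therefore dies in this quotient, and a factorization of
    [Delta^2] into three powers of half-twists, one of them a cube, becomes
    [x y = -1] with [x^3 = y^3 = 1].  Since [-1] is central, [x] and [y]
    commute, so that [-1 = (-1)^3 = x^3 y^3 = 1], which is absurd in odd
    characteristic. *)

Import GRing.Theory.
Local Open Scope group_scope.

(** Centrality of [x * y] is what makes [x] and [y] commute, so that cubing
    distributes over the product. *)
Lemma expg_central_mul (G : groupType) (n : nat) (x y : G) :
  (forall g, commute (x * y) g) -> x ^+ n = 1 -> y ^+ n = 1 -> (x * y) ^+ n = 1.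
Proof.
move=> cxy xn yn; rewrite expgMn ?xn ?yn ?mulg1 //.
by apply: (mulgI x); rewrite [RHS]mulgA (cxy x).
Qed.

(** The transvections along the two vectors of the standard basis of [F_3^2];
    the signs are opposite so that they satisfy the braid relation. *)
Definition transvection1 : 'M['F_3]_2 := (1 + delta_mx 0 1)%R.
Definition transvection2 : 'M['F_3]_2 := (1 - delta_mx 1 0)%R.

Ltac mx2_compute :=
  apply/matrixP; do 2![case; case=> [|[|//]] ?]; apply: val_inj;
  rewrite /transvection1 /transvection2 ?exprS ?expr0 ?mulr1;
  rewrite -?mulmxE !(mxE, big_ord_recl, big_ord0).

Lemma transvection1_cube : (transvection1 ^+ 3 = 1)%R.
Proof. by mx2_compute. Qed.

Lemma transvection2_cube : (transvection2 ^+ 3 = 1)%R.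
Proof. by mx2_compute. Qed.

(** Both sides of the braid relation are the rotation by a right angle, whose
    square is [-1]. *)
Lemma transvection121 :
  (transvection1 * transvection2 * transvection1 =
   delta_mx 0 1 - delta_mx 1 0)%R.
Proof. by mx2_compute. Qed.

Lemma transvection212 :
  (transvection2 * transvection1 * transvection2 =
   delta_mx 0 1 - delta_mx 1 0)%R.
Proof. by mx2_compute. Qed.

Lemma rotation_sqr : ((delta_mx 0 1 - delta_mx 1 0) ^+ 2 = -1 :> 'M['F_3]_2)%R.
Proof. by mx2_compute. Qed.

Lemma transvection1_unit : transvection1 \is a GRing.unit.
Proof. by rewrite -(@unitrX_pos _ _ 3) // transvection1_cube unitr1. Qed.

Lemma transvection2_unit : transvection2 \is a GRing.unit.
Proof. by rewrite -(@unitrX_pos _ _ 3) // transvection2_cube unitr1. Qed.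

(** Through this homomorphism the theorem becomes a computation with elements
    of order 3: half-twists become such elements, while the full twist [Delta^2]
    becomes central and of order prime to 3. *)
Lemma B3_mod3_representation :
  exists f : UMagmaMorphism.type B3 {unit 'M['F_3]_2},
    f sigma1 ^+ 3 = 1 /\ val (f (Delta ^+ 2)) = (-1)%R.
Proof.
pose a : {unit 'M['F_3]_2} := Sub transvection1 transvection1_unit.
pose b : {unit 'M['F_3]_2} := Sub transvection2 transvection2_unit.
have ab : a * b * a = b * a * b.
  by apply: val_inj; rewrite /= transvection121 transvection212.
have [f [fa fb fM]] := B3_universal ab.
have f1 : f 1 = 1 by apply: (mulgI (f 1)); rewrite -fM !mulg1.
pose fm := isUMagmaMorphism.Build _ _ f (f1, fM).
pose F : UMagmaMorphism.type B3 {unit 'M['F_3]_2} := HB.pack f fm.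
exists F; split.
  by rewrite /= fa; apply: val_inj; exact: transvection1_cube.
rewrite /= /Delta expg2 !fM fa fb /=.
by rewrite transvection121 -expr2 rotation_sqr.
Qed.

(** Only the order of the image of [sigma1] matters, since all half-twists are
    conjugate to it. *)
Lemma half_twist_expg (G : groupType) (f : UMagmaMorphism.type B3 G)
    (n : nat) (t : B3) :
  f sigma1 ^+ n = 1 -> positive_half_twist t -> f t ^+ n = 1.
Proof. by move=> fn [y ->]; rewrite gmulfJ -conjXg fn conj1g. Qed.

Theorem lemma4p55 :
  ~ exists s : 3.-tuple B3,
      [/\ factorization (Delta ^+ 2) s,
          forall i, half_twist_power (tnth s i)
        & exists i, half_twist_cube (tnth s i)].
Proof.
move=> [s [fact_s pow_s [j [t [t_ht sj]]]]].
have [f [f3 fD]] := B3_mod3_representation.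
have pow3 i : f (tnth s i) ^+ 3 = 1.
  have [e [u [_ u_ht ->]]] := pow_s i.
  by rewrite gmulfXn expgnAC (half_twist_expg _ f _ _ f3 u_ht) expg1n.
have cube1 : f (tnth s j) = 1 by rewrite sj gmulfXn (half_twist_expg _ f _ _ f3 t_ht).
have central g : commute (f (Delta ^+ 2)) g.
  by apply: val_inj; rewrite /= fD mulN1r mulrN1.
have [x [y [xy x3 y3]]] :
    exists x y, [/\ f (Delta ^+ 2) = x * y, x ^+ 3 = 1 & y ^+ 3 = 1].
  (* The cube is trivial in the quotient, so the two other factors remain, in
     their original order, whatever the position of the cube. *)
  rewrite fact_s !big_ord_recl big_ord0 mulg1 !gmulfM.
  case: j cube1 {sj} => [[|[|[|//]]] lt_j] cube1.
  - exists (f (tnth s (lift ord0 ord0))).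
    exists (f (tnth s (lift ord0 (lift ord0 ord0)))).
    split=> //; rewrite -[RHS]mul1g -cube1.
    by congr (f (tnth s _) * _); apply: val_inj.
  - exists (f (tnth s ord0)), (f (tnth s (lift ord0 (lift ord0 ord0)))).
    split=> //; congr (_ * _); rewrite -[RHS]mul1g -cube1.
    by congr (f (tnth s _) * _); apply: val_inj.
  exists (f (tnth s ord0)), (f (tnth s (lift ord0 ord0))).
  split=> //; congr (_ * _); rewrite -[RHS]mulg1 -cube1.
  by congr (_ * f (tnth s _)); apply: val_inj.
have : f (Delta ^+ 2) ^+ 3 = 1.
  by rewrite xy; apply: expg_central_mul x3 y3 => g; rewrite -xy.
move/(congr1 val); rewrite FinRing.val_unitX fD => /matrixP/(_ ord0 ord0).
(* The upper left entry of (-1)^3 = 1 reads -1 = 1 in 'F_3. *)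
by rewrite !exprS expr0 mulr1 mulrNN mulr1 mulr1 !mxE.
Qed.
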